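(* Let $m\ge2$ and let $\omega=\sqrt{-1}\,\partial\bar\partial f(S)$ be a $U(m)$-invariant Kähler metric on $\mathbb{C}^m\setminus\{0\}$, where $S=\sum_{i=1}^m|z_i|^2$. For $S>0$, the principal curvatures of the hypersphere $\Sigma_S^{2m-1}=\{z\in\mathbb{C}^m:\sum_{i=1}^m|z_i|^2=S\}\subset\mathbb{C}^m\setminus\{0\}$ are $$\lambda_1=\lambda_2=\dots=\lambda_{2m-2}=-\frac{\sqrt{f_S+S f_{SS}}}{f_S\sqrt S},\qquad \lambda_{2m-1}=-\frac{f_S+3S f_{SS}+S^2f_{SSS}}{(f_S+S f_{SS})^{3/2}\sqrt S}.$$
   Context: $f$ is a smooth real function of $S\in(0,\infty)$; subscripts $S$ denote derivatives in $S$. That $\omega$ is a Kähler metric means $f_S>0$ and $f_S+Sf_{SS}>0$ for $S>0$. The associated Riemannian metric $g$ is the one with Hermitian matrix $\big(f_S\delta_{ij}+f_{SS}\bar z_iz_j\big)_{i,j}$, normalized so that $f(S)=S$ gives the Euclidean metric: if $n$ is the Euclidean unit outward normal of the sphere, $J$ the standard complex structure, and $e_1,\dots,e_{2m-2}$ a Euclidean-orthonormal basis of the orthogonal complement of $\langle n,Jn\rangle$, then in the basis $(e_1,\dots,e_{2m-2},Jn,n)$ the matrix of $g$ is $\mathrm{diag}\big(f_S I_{2m-2},(f_S+Sf_{SS})I_2\big)$. The second fundamental form of a hypersurface with respect to a $g$-unit normal $\nu$ is $\Pi_\nu(X,X)=g(\nabla_XX,\nu)$ for tangent $X$, with $\nabla$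 the Levi-Civita connection of $g$. The principal curvatures are the eigenvalues of $\Pi_\nu$ with respect to $g$, and here $\nu$ is the outward unit normal. *)

(* Defs.v *)
From HB Require Import structures.
From mathcomp Require Import all_boot all_order all_algebra.
From mathcomp Require Import complex.
From mathcomp Require Import all_classical all_reals all_analysis.
From mathcomp Require Import ring lra.

Set Implicit Arguments.
Unset Strict Implicit.
Unset Printing Implicit Defensive.

Import Order.TTheory GRing.Theory Num.Theory.
Import numFieldNormedType.Exports.

Local Open Scope classical_set_scope.
Local Open Scope ring_scope.

(* [F] is k times Frechet differentiable on the open set [U]. *)
Fixpoint differentiable_upto (R : realType) (n p : nat) (k : nat)
    (U : set 'rV[R]_n) (F : 'rV[R]_n -> 'rV[R]_p) : Prop :=
  if k is k'.+1 then
    (forall x, U x -> differentiable F x) /\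
    (forall v, differentiable_upto k' U (fun x => 'D_v F x))
  else True.

Definition smooth_on (R : realType) (n p : nat)
    (U : set 'rV[R]_n) (F : 'rV[R]_n -> 'rV[R]_p) : Prop :=
  forall k, differentiable_upto k U F.

(* A metric is a field [g] of Gram matrices; [inner (g x)] is the inner product
   it induces on tangent vectors at [x]. *)
Definition inner (R : realType) (n : nat) (G : 'M[R]_n) (u v : 'rV[R]_n) : R :=
  (u *m G *m v^T) 0 0.

(* [partial_metric g x a b c] is the derivative of g_bc along the a-th
   coordinate. *)
Definition partial_metric (R : realType) (n : nat)
    (g : 'rV[R]_n -> 'M[R]_n) (x : 'rV[R]_n) (a b c : 'I_n) : R :=
  'D_(delta_mx 0 a) (fun y => g y b c) x.

(* [christoffel g x a b c] is Gamma^c_{ab}. *)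
Definition christoffel (R : realType) (n : nat)
    (g : 'rV[R]_n -> 'M[R]_n) (x : 'rV[R]_n) (a b c : 'I_n) : R :=
  2^-1 * \sum_(d < n) invmx (g x) c d *
    (partial_metric g x a b d + partial_metric g x b a d
     - partial_metric g x d a b).

(* The Levi-Civita connection nabla_X Y of [g], on an open subset of R^n in its
   global coordinates. *)
Definition nabla (R : realType) (n : nat) (g : 'rV[R]_n -> 'M[R]_n)
    (X Y : 'rV[R]_n -> 'rV[R]_n) (x : 'rV[R]_n) : 'rV[R]_n :=
  'D_(X x) Y x +
  \row_c \sum_a \sum_b christoffel g x a b c * X x 0 a * Y x 0 b.

(* The Christoffel symbols are characterized by the vanishing of the torsion
   and by the compatibility with the metric. *)
Lemma christoffelP (R : realType) (n : nat) (g : 'rV[R]_n -> 'M[R]_n)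
    (x : 'rV[R]_n) (Gamma : 'I_n -> 'I_n -> 'I_n -> R) :
  (forall y, (g y)^T = g y) -> g x \in unitmx ->
  ((forall a b c, Gamma a b c = Gamma b a c) /\
   (forall a b c, partial_metric g x a b c =
      \sum_d Gamma a b d * g x d c + \sum_d Gamma a c d * g x b d))
  <-> (forall a b c, Gamma a b c = christoffel g x a b c).
Proof.
move=> gsym gu.
have gs y b c : g y b c = g y c b by rewrite -{1}gsym mxE.
have ps a b c : partial_metric g x a b c = partial_metric g x a c b.
  by rewrite /partial_metric; congr ('D_ _ _ x); apply/funext => y; apply: gs.
pose L a b c := 2^-1 * (partial_metric g x a b c + partial_metric g x b a c
     - partial_metric g x c a b).
have chE a b c : christoffel g x a b c = \sum_d L a b d * invmx (g x) d c.
  rewrite /christoffel mulr_sumr; apply: eq_bigr => d _.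
  have -> : invmx (g x) d c = invmx (g x) c d.
    by rewrite -[in RHS]gsym -trmx_inv mxE.
  by rewrite /L; ring.
have lowE a b c : \sum_d christoffel g x a b d * g x d c = L a b c.
  have := congr1 (fun A : 'rV_n => A 0 c)
    (mulmxKV gu (\row_d L a b d)).
  rewrite !mxE => <-; apply: eq_bigr => d _; congr (_ * _).
  by rewrite chE mxE; apply: eq_bigr => e _; rewrite mxE.
split=> [[tor met] a b c|GE].
  have gE : \row_d Gamma a b d *m g x = \row_d L a b d.
    apply/rowP => e; rewrite !mxE.
    under eq_bigr do rewrite mxE.
    set s := fun i j k => \sum_d Gamma i j d * g x d k.
    have metE i j k : partial_metric g x i j k = s i j k + s i k j.
      rewrite met /s; congr (_ + _); apply: eq_bigr => d _.
      by rewrite (gs x j d).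
    have tE i j k : s i j k = s j i k.
      by apply: eq_bigr => d _; rewrite tor.
    rewrite -/(s a b e) /L !metE (tE b a e) (tE e a b) (tE e b a).
    by field.
  have := congr1 (fun A : 'rV_n => (A *m invmx (g x)) 0 c) gE.
  rewrite /= mulmxK // !mxE => ->; rewrite chE.
  by apply: eq_bigr => d _; rewrite mxE.
split=> [a b c|a b c].
  rewrite !GE !chE; apply: eq_bigr => d _; congr (_ * _).
  by rewrite /L (ps d a b); ring.
have -> : \sum_d Gamma a b d * g x d c = L a b c.
  by rewrite -lowE; apply: eq_bigr => d _; rewrite GE.
have -> : \sum_d Gamma a c d * g x b d = L a c b.
  by rewrite -lowE; apply: eq_bigr => d _; rewrite GE (gs x b d).
by rewrite /L (ps b a c) (ps c a b) (ps a c b); field.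
Qed.

(* For a regular level set this is the tangent space at [p]. *)
Definition tangent (R : realType) (n : nat) (rho : 'rV[R]_n -> R)
    (p v : 'rV[R]_n) : Prop :=
  'D_v rho p = 0.

Definition tangent_field (R : realType) (n : nat) (U : set 'rV[R]_n)
    (rho : 'rV[R]_n -> R) (c : R) (X : 'rV[R]_n -> 'rV[R]_n) : Prop :=
  smooth_on U X /\ forall q, U q -> rho q = c -> tangent rho q (X q).

(* "Outward" means pointing towards increasing values of [rho]. *)
Definition outward_unit_normal (R : realType) (n : nat)
    (g : 'rV[R]_n -> 'M[R]_n) (rho : 'rV[R]_n -> R) (p nu : 'rV[R]_n) : Prop :=
  [/\ forall v, tangent rho p v -> inner (g p) v nu = 0,
      inner (g p) nu nu = 1
    & 0 < 'D_nu rho p].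

(* [second_fundamental_form U g rho c p nu v w r] says that Pi_nu(v, w) = r,
   for [v], [w] tangent at [p]: they extend to tangent vector fields [X], [Y],
   and r = g(nabla_X Y, nu) whatever the extensions. *)
Definition second_fundamental_form (R : realType) (n : nat)
    (U : set 'rV[R]_n) (g : 'rV[R]_n -> 'M[R]_n) (rho : 'rV[R]_n -> R) (c : R)
    (p nu v w : 'rV[R]_n) (r : R) : Prop :=
  (exists X Y, [/\ tangent_field U rho c X, tangent_field U rho c Y,
                   X p = v & Y p = w]) /\
  (forall X Y, tangent_field U rho c X -> tangent_field U rho c Y ->
     X p = v -> Y p = w -> inner (g p) (nabla g X Y p) nu = r).

(* [l] lists, with multiplicities, the eigenvalues of Pi_nu with respect to
   [g]: the rows of [E] form a basis of the tangent space whose i-th vector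
   [e] satisfies Pi_nu(e, w) = l_i g(e, w) for every tangent [w]. *)
Definition principal_curvatures (R : realType) (n : nat)
    (U : set 'rV[R]_n) (g : 'rV[R]_n -> 'M[R]_n) (rho : 'rV[R]_n -> R) (c : R)
    (p nu : 'rV[R]_n) (l : seq R) : Prop :=
  exists E : 'M[R]_(size l, n),
    [/\ row_free E,
        forall v : 'rV[R]_n, (v <= E)%MS <-> tangent rho p v
      & forall (i : 'I_(size l)) (w : 'rV[R]_n), tangent rho p w ->
          second_fundamental_form U g rho c p nu (row i E) w
            (l`_i * inner (g p) (row i E) w)].

(* C^m is identified with R^(m+m): the first [m] coordinates are the real parts
   and the last [m] the imaginary parts. *)
Definition zcoord (R : realType) (m : nat) (p : 'rV[R]_(m + m)) (i : 'I_m) :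
    R[i] :=
  (p 0 (lshift m i) +i* p 0 (rshift m i))%C.

Definition normsq (R : realType) (m : nat) (p : 'rV[R]_(m + m)) : R :=
  \sum_(i < m) (p 0 (lshift m i) ^+ 2 + p 0 (rshift m i) ^+ 2).

Definition smooth_pos (R : realType) (f : R -> R) : Prop :=
  forall k S, 0 < S -> derivable (derive1n k f) S 1.

(* Positivity of sqrt(-1) ddbar f(S) on C^m minus the origin. *)
Definition kaehler_profile (R : realType) (f : R -> R) : Prop :=
  forall S, 0 < S ->
    0 < derive1n 1 f S /\ 0 < derive1n 1 f S + S * derive1n 2 f S.

Definition hermitian_matrix (R : realType) (m : nat) (f : R -> R)
    (p : 'rV[R]_(m + m)) : 'M[R[i]]_m :=
  \matrix_(i, j)
    ((derive1n 1 f (normsq p))%:C * (i == j)%:R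
     + (derive1n 2 f (normsq p))%:C * ((zcoord p i)^*%C * zcoord p j))%C.

(* g(u, v) = Re (sum_ij h_ij u_i conj(v_j)), with Gram matrix
   g(d_a, d_b) in the real coordinates. *)
Definition kaehler_metric (R : realType) (m : nat) (f : R -> R)
    (p : 'rV[R]_(m + m)) : 'M[R]_(m + m) :=
  \matrix_(a, b)
    complex.Re (\sum_(i < m) \sum_(j < m) hermitian_matrix f p i j *
      (zcoord (delta_mx 0 a) i * (zcoord (delta_mx 0 b) j)^*%C)).

(* [ddbar F p i j] is d^2 F / dz_i dzbar_j, where
   d/dz_i = (d/dx_i - sqrt(-1) d/dy_i) / 2 and
   d/dzbar_j = (d/dx_j + sqrt(-1) d/dy_j) / 2. *)
Definition ddbar (R : realType) (m : nat) (F : 'rV[R]_(m + m) -> R)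
    (p : 'rV[R]_(m + m)) : 'M[R[i]]_m :=
  let d2 a b := 'D_(delta_mx 0 a) (fun q => 'D_(delta_mx 0 b) F q) p in
  \matrix_(i, j)
    ((4^-1 * (d2 (lshift m i) (lshift m j) + d2 (rshift m i) (rshift m j)))
     +i* (4^-1 * (d2 (lshift m i) (rshift m j) - d2 (rshift m i) (lshift m j))))%C.

Lemma normsqE (R : realType) (m : nat) :
  @normsq R m = fun p => \sum_(a < m + m) p 0 a ^+ 2.
Proof. by apply/funext => p; rewrite /normsq big_split big_split_ord. Qed.

Lemma differentiable_normsq (R : realType) (m : nat) (p : 'rV[R]_(m + m)) :
  differentiable (@normsq R m) p.
Proof.
rewrite normsqE.
have -> : (fun q : 'rV[R]_(m + m) => \sum_(a < m + m) q 0 a ^+ 2) =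
    \sum_(a < m + m) (fun q : 'rV[R]_(m + m) => q 0 a * q 0 a).
  by apply/funext => q; rewrite fct_sumE; apply: eq_bigr => a _; rewrite expr2.
apply: differentiable_sum => a.
by apply: differentiableM; apply: differentiable_coord.
Qed.

Lemma is_derive_coord (R : realType) (n : nat) (p v : 'rV[R]_n) (a : 'I_n) :
  is_derive p v (fun q : 'rV[R]_n => q 0 a) (v 0 a).
Proof.
apply: DeriveDef; first exact/diff_derivable/differentiable_coord.
rewrite deriveE; last exact: differentiable_coord.
have @f : {linear 'rV[R]_n -> R}.
  by exists (fun N : 'rV[R]_n => N 0 a); do 2![eexists]; do ?[constructor];
     rewrite ?mxE// => ? *; rewrite ?mxE//; move=> ?; rewrite !mxE.
rewrite (_ : (fun _ => _) = f) // diff_lin //; exact: coord_continuous.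
Qed.

Lemma is_derive_normsq (R : realType) (m : nat) (p : 'rV[R]_(m + m)) a :
  is_derive p (delta_mx 0 a) (@normsq R m) (2 * p 0 a).
Proof.
rewrite normsqE.
have -> : (fun q : 'rV[R]_(m + m) => \sum_(a < m + m) q 0 a ^+ 2) =
    \sum_(a < m + m) (fun q : 'rV[R]_(m + m) => q 0 a) ^+ 2.
  by apply/funext => q; rewrite fct_sumE; apply: eq_bigr.
apply: (@is_derive_eq _ _ _ _ _ _ _ _ (@is_derive_sum _ _ _ _ _ _ _ (fun i => 2 * p 0 i * (delta_mx 0 a : 'rV[R]_(m + m)) 0 i) _)).
  move=> i; apply: (@is_derive_eq _ _ _ _ _ _ _ _
    (@is_deriveX _ _ _ _ _ _ _ (is_derive_coord _ _ _))).
  by rewrite expr1.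
rewrite (bigD1 a) //= big1 ?addr0 => [|i /negPf ia].
  by rewrite mxE !eqxx mulr1.
by rewrite mxE ia andbF mulr0.
Qed.

Lemma is_derive_normsq_comp (R : realType) (m : nat) (h : R -> R)
    (p : 'rV[R]_(m + m)) a :
  derivable h (normsq p) 1 ->
  is_derive p (delta_mx 0 a) (fun q => h (normsq q))
    (derive1 h (normsq p) * (2 * p 0 a)).
Proof.
move=> /derivable1_diffP dh.
have dn := differentiable_normsq p.
have dc : differentiable (h \o @normsq R m) p by exact: differentiable_comp.
apply: DeriveDef; first exact: diff_derivable.
rewrite (deriveE _ dc) diff_comp //= diff1E //= -deriveE //.
have := is_derive_normsq p a => dnp; rewrite derive_val.
by rewrite [_ *: _]mulrC.
Qed.

Lemma ddbarE (R : realType) (m : nat) (f : R -> R) (p : 'rV[R]_(m + m)) :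
  smooth_pos f -> 0 < normsq p ->
  ddbar (fun q => f (normsq q)) p = hermitian_matrix f p.
Proof.
move=> fs p0.
have d2E a b : 'D_(delta_mx 0 a)
    (fun q => 'D_(delta_mx 0 b) (fun q => f (normsq q)) q) p =
    4 * derive1n 2 f (normsq p) * p 0 a * p 0 b +
    2 * derive1n 1 f (normsq p) * (a == b)%:R.
  have np : \forall q \near p, 0 < normsq q.
    have c := differentiable_continuous (differentiable_normsq p).
    exact: (cvgr_gt _ c).
  rewrite (@near_eq_derive _ _ _ _
    ((fun q => derive1n 1 f (normsq q)) * (fun q => 2 * q 0 b))); last first.
    near=> q; have q0 : 0 < normsq q by near: q.
    by have /(is_derive_normsq_comp b) dq := fs 0%N _ q0; rewrite derive_val.
  have /(is_derive_normsq_comp a) d1 := fs 1%N _ p0.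
  have d0 : is_derive p (delta_mx 0 a) (fun q : 'rV[R]_(m + m) => 2 * q 0 b)
      (2 * (a == b)%:R).
    have -> : (fun q : 'rV[R]_(m + m) => 2 * q 0 b) =
        2 \*: (fun q : 'rV[R]_(m + m) => q 0 b) by [].
    have /(is_deriveZ 2) := is_derive_coord p (delta_mx 0 a) b.
    by rewrite mxE eqxx /= eq_sym.
  rewrite derive_val /derive1n /= /GRing.scale /=.
  by ring.
apply/matrixP => i j; rewrite !mxE !d2E.
rewrite !(inj_eq (@lshift_inj _ _)) !(inj_eq (@rshift_inj _ _)).
rewrite eq_lrshift eq_rlshift /zcoord.
case: (i == j); simpc; congr (_ +i* _)%C; rewrite /=; field.
Unshelve. all: by end_near.
Qed.

Lemma kaehler_metric_sym (R : realType) (m : nat) (f : R -> R)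
    (p : 'rV[R]_(m + m)) : (kaehler_metric f p)^T = kaehler_metric f p.
Proof.
apply/matrixP => a b; rewrite !mxE exchange_big /= !raddf_sum /=.
apply: eq_bigr => i _; rewrite !raddf_sum /=; apply: eq_bigr => j _.
rewrite !mxE eq_sym /zcoord; case: (i == j);
  rewrite /= !mxE /=; ring.
Qed.

(* Main.v *)
(* In real coordinates [g(u, v) = f_S u.v + f_SS ((u.p)(v.p) + (u.Jp)(v.Jp))],
   so the outward unit normal is [nu = p / (sqrt S sqrt (f_S + S f_SS))].  For
   tangent fields [X], [Y], the function [q.Y(q)] vanishes on the sphere, hence
   [D_X Y . p = - X.Y], and the Koszul formula applied to constant vectors gives
   the Christoffel part of [g(nabla_X Y, p)].  Altogether
     [g(nabla_X Y, p) = - (f_S + S f_SS) X.Y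
                        - (2 f_SS + S f_SSS) (X.Jp) (Y.Jp)],
   which is diagonalized, simultaneously with [g], by a basis of the orthogonal
   complement of [p] and [Jp], followed by [Jp]. *)

Require Import Defs.
From mathcomp Require Import all_boot all_order all_algebra.
From mathcomp Require Import complex.
From mathcomp Require Import all_classical all_reals all_analysis.
From mathcomp Require Import ring lra zify.
Import Order.TTheory GRing.Theory Num.Theory.
Import numFieldNormedType.Exports.
Local Open Scope classical_set_scope.
Local Open Scope ring_scope.

Set Implicit Arguments.
Unset Strict Implicit.
Unset Printing Implicit Defensive.

(** * Bilinear algebra of Gram matrices and the Koszul formula *)

Section Inner.
Variables (R : realType) (n : nat).
Implicit Types (G H : 'M[R]_n) (g : 'rV[R]_n -> 'M[R]_n) (x u v w : 'rV[R]_n).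

Lemma innerE G u v : inner G u v = \sum_a \sum_b u 0 a * v 0 b * G a b.
Proof.
rewrite /inner mxE exchange_big /=; apply: eq_bigr => b _.
by rewrite !mxE mulr_suml; apply: eq_bigr => a _; rewrite mulrAC.
Qed.

Lemma inner_delta G a b : inner G (delta_mx 0 a) (delta_mx 0 b) = G a b.
Proof. by rewrite /inner -rowE trmx_delta -colE !mxE. Qed.

Lemma innerDl G u v w : inner G (u + v) w = inner G u w + inner G v w.
Proof. by rewrite /inner !mulmxDl mxE. Qed.

Lemma innerDr G u v w : inner G u (v + w) = inner G u v + inner G u w.
Proof. by rewrite /inner linearD /= mulmxDr mxE. Qed.

Lemma innerZl G k u w : inner G (k *: u) w = k * inner G u w.
Proof. by rewrite /inner -!scalemxAl mxE. Qed.

Lemma innerZr G k u w : inner G u (k *: w) = k * inner G u w.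
Proof. by rewrite /inner linearZ /= -scalemxAr mxE. Qed.

Lemma innerNr G u w : inner G u (- w) = - inner G u w.
Proof. by rewrite -scaleN1r innerZr mulN1r. Qed.

Lemma innerDm G H u v : inner (G + H) u v = inner G u v + inner H u v.
Proof. by rewrite /inner mulmxDr mulmxDl mxE. Qed.

Lemma innerZm k G u v : inner (k *: G) u v = k * inner G u v.
Proof. by rewrite /inner -scalemxAr -scalemxAl mxE. Qed.

Lemma derive_delta (V : normedModType R) (F : 'rV[R]_n -> V) x u :
  differentiable F x -> 'D_u F x = \sum_a u 0 a *: 'D_(delta_mx 0 a) F x.
Proof.
move=> dF; rewrite deriveE // {1}(row_sum_delta u) linear_sum.
by apply: eq_bigr => a _; rewrite linearZ /= deriveE.
Qed.

(** Stated as an equality of functions, so that the differentiation rules for sums and scalings of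
    functions apply to the entries of [g]. *)
Lemma inner_fun g v w : (fun y => inner (g y) v w) =
  \sum_b \sum_c (v 0 b * w 0 c) \*: (fun y => g y b c).
Proof.
apply/funext => y; rewrite innerE fct_sumE; apply: eq_bigr => b _.
by rewrite fct_sumE.
Qed.

Lemma differentiable_inner g x v w :
  (forall b c, differentiable (fun y => g y b c) x) ->
  differentiable (fun y => inner (g y) v w) x.
Proof.
move=> dg; rewrite inner_fun.
apply: differentiable_sum => b; apply: differentiable_sum => c.
exact: differentiableZ.
Qed.

Lemma derive_inner g x u v w :
  (forall b c, differentiable (fun y => g y b c) x) ->
  'D_u (fun y => inner (g y) v w) x =
  \sum_a \sum_b \sum_c u 0 a * v 0 b * w 0 c * partial_metric g x a b c.
Proof.
move=> dg; rewrite derive_delta; last exact: differentiable_inner.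
apply: eq_bigr => a _.
rewrite inner_fun.
have dgd b c : derivable (fun y => g y b c) x (delta_mx 0 a).
  exact: diff_derivable.
rewrite derive_sum => [|b]; last first.
  by apply: derivable_sum => c; apply: derivableZ.
rewrite scaler_sumr; apply: eq_bigr => b _.
rewrite derive_sum => [|c]; last exact: derivableZ.
rewrite scaler_sumr; apply: eq_bigr => c _.
by rewrite deriveZ // /partial_metric /GRing.scale /= !mulrA.
Qed.

(* The Koszul formula for constant vector fields. *)
Lemma inner_christoffel g x u v w :
  (forall y, (g y)^T = g y) -> g x \in unitmx ->
  (forall b c, differentiable (fun y => g y b c) x) ->
  inner (g x)
    (\row_c \sum_a \sum_b christoffel g x a b c * u 0 a * v 0 b) w =
  2^-1 * ('D_u (fun y => inner (g y) v w) x + 'D_v (fun y => inner (g y) u w) x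
          - 'D_w (fun y => inner (g y) u v) x).
Proof.
move=> gsym gu dg; have gs b c : g x b c = g x c b by rewrite -{1}gsym mxE.
have [tor met] :=
  (christoffelP (christoffel g x) gsym gu).2 (fun _ _ _ => erefl).
(* These are the Christoffel symbols with the upper index lowered. *)
pose L a b c := \sum_d christoffel g x a b d * g x d c.
have Ls a b c : L a b c = L b a c by apply: eq_bigr => d _; rewrite tor.
have metL a b c : partial_metric g x a b c = L a b c + L a c b.
  by rewrite met; congr (_ + _); apply: eq_bigr => d _; rewrite gs.
(* By compatibility each partial derivative is a sum of two symbols; symmetry in the first two
   indices cancels all but two copies of [L a b c]. *)
have LE a b c : L a b c = 2^-1 * (partial_metric g x a b c
    + partial_metric g x b a c - partial_metric g x c a b).
  by rewrite !metL (Ls b a c) (Ls c a b) (Ls c b a); field.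
rewrite !derive_inner //.
transitivity (\sum_a \sum_b \sum_c u 0 a * v 0 b * w 0 c * L a b c).
  rewrite innerE; under eq_bigr => d _.
    under eq_bigr => c _.
      rewrite mxE mulr_suml mulr_suml.
      under eq_bigr do rewrite mulr_suml mulr_suml.
      over.
    rewrite exchange_big /=; under eq_bigr do rewrite exchange_big /=.
    over.
  rewrite exchange_big /=; apply: eq_bigr => a _.
  rewrite exchange_big /=; apply: eq_bigr => b _.
  rewrite exchange_big /=; apply: eq_bigr => c _.
  by rewrite /L mulr_sumr; apply: eq_bigr => d _; ring.
(* The summation indices are renamed so that all three derivatives carry the same weight
   [u 0 a * v 0 b * w 0 c] and can be compared termwise. *)
have -> : \sum_a \sum_b \sum_c v 0 a * u 0 b * w 0 c * partial_metric g x a b c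
    = \sum_a \sum_b \sum_c u 0 a * v 0 b * w 0 c * partial_metric g x b a c.
  rewrite exchange_big /=; apply: eq_bigr => a _; apply: eq_bigr => b _.
  by apply: eq_bigr => c _; ring.
have -> : \sum_a \sum_b \sum_c w 0 a * u 0 b * v 0 c * partial_metric g x a b c
    = \sum_a \sum_b \sum_c u 0 a * v 0 b * w 0 c * partial_metric g x c a b.
  rewrite exchange_big /=; apply: eq_bigr => a _.
  rewrite exchange_big /=; apply: eq_bigr => b _.
  by apply: eq_bigr => c _; ring.
rewrite -big_split -sumrB mulr_sumr; apply: eq_bigr => a _.
rewrite -big_split -sumrB mulr_sumr; apply: eq_bigr => b _.
rewrite -big_split -sumrB mulr_sumr; apply: eq_bigr => c _.
by rewrite LE /=; ring.
Qed.

End Inner.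

(** * The Euclidean inner product and linear vector fields *)

Local Notation dot := (inner 1%:M).

Section Dot.
Variables (R : realType) (n : nat).
Implicit Types (u v w p : 'rV[R]_n).

Lemma dotE u v : dot u v = (u *m v^T) 0 0.
Proof. by rewrite /inner mulmx1. Qed.

Lemma dot_sum u v : dot u v = \sum_a u 0 a * v 0 a.
Proof. by rewrite dotE mxE; apply: eq_bigr => a _; rewrite mxE. Qed.

Lemma dotC u v : dot u v = dot v u.
Proof. by rewrite !dot_sum; apply: eq_bigr => a _; rewrite mulrC. Qed.

Lemma dot_ge0 u : 0 <= dot u u.
Proof. by rewrite dot_sum sumr_ge0 // => a _; apply: sqr_ge0. Qed.

Lemma dot_eq0 u : (dot u u == 0) = (u == 0).
Proof.
apply/idP/eqP => [|->]; last by rewrite dotE mul0mx mxE.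
rewrite dot_sum psumr_eq0 => [/allP u0|a _]; last exact: sqr_ge0.
apply/rowP => a; rewrite mxE; apply/eqP.
by have := u0 a (mem_index_enum a); rewrite mulf_eq0 orbb.
Qed.

Lemma innerr_fun (G : 'M[R]_n) v :
  inner G v = \sum_b (v *m G) 0 b \*: (fun w : 'rV[R]_n => w 0 b).
Proof.
apply/funext => w; rewrite /inner mxE fct_sumE.
by apply: eq_bigr => b _; rewrite [_^T _ _]mxE.
Qed.

Lemma is_derive_innerr (G : 'M[R]_n) p u v :
  is_derive p u (inner G v) (inner G v u).
Proof.
have -> : inner G v u = \sum_b (v *m G) 0 b *: u 0 b.
  by rewrite innerr_fun fct_sumE.
rewrite innerr_fun.
apply: is_derive_sum => b.
exact/is_deriveZ/is_derive_coord.
Qed.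

Lemma differentiable_innerr (G : 'M[R]_n) p v : differentiable (inner G v) p.
Proof.
rewrite innerr_fun.
by apply: differentiable_sum => b; apply/differentiableZ/differentiable_coord.
Qed.

Lemma differentiable_mulmxr p (A : 'M[R]_n) :
  differentiable (fun q : 'rV[R]_n => q *m A) p.
Proof.
have -> : (fun q : 'rV[R]_n => q *m A) =
    \sum_i (fun q : 'rV[R]_n => q 0 i *: row i A).
  by apply/funext => q; rewrite mulmx_sum_row fct_sumE.
apply: differentiable_sum => i.
exact/differentiableZl/differentiable_coord.
Qed.

Lemma derive_mulmxr p v (A : 'M[R]_n) :
  'D_v (fun q : 'rV[R]_n => q *m A) p = v *m A.
Proof.
rewrite deriveE; last exact: differentiable_mulmxr.
rewrite (diff_lin (f := mulmxr A)) // => q.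
exact/differentiable_continuous/differentiable_mulmxr.
Qed.

(** A linear field has constant directional derivatives, and constants are smooth. This provides the
    smoothness of the tangent extensions below. *)
Lemma smooth_mulmxr (U : set 'rV[R]_n) (A : 'M[R]_n) :
  smooth_on U (fun q : 'rV[R]_n => q *m A).
Proof.
have smooth_cst k c : differentiable_upto k U (fun=> c : 'rV[R]_n).
  elim: k c => //= k IH c; split=> // v.
  by have -> : (fun x => 'D_v (fun=> c) x) = (fun=> 0 : 'rV[R]_n);
    [apply/funext => x; apply: derive_cst | apply: IH].
case=> //= k; split=> [x _|v]; first exact: differentiable_mulmxr.
have -> : (fun x => 'D_v (fun q : 'rV[R]_n => q *m A) x) = (fun=> v *m A).
  by apply/funext => x; apply: derive_mulmxr.
exact: smooth_cst.
Qed.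

End Dot.

(* The matrix of multiplication by [sqrt(-1)], acting on row vectors. *)
Definition Jmx (R : realType) (m : nat) : 'M[R]_(m + m) :=
  block_mx 0 1%:M (- 1%:M) 0.
Local Notation J := (Jmx _ _).

(** * The complex structure and the metric in real coordinates *)

Section Sphere.
Variables (R : realType) (m : nat).
Implicit Types (p q u v w nu : 'rV[R]_(m + m)) (f : R -> R) (S : R).

Lemma normsq_dot p : normsq p = dot p p.
Proof. by rewrite normsqE dot_sum; apply: eq_bigr => a _; rewrite expr2. Qed.

Lemma mulJ_lshift p i : (p *m J) 0 (lshift m i) = - p 0 (rshift m i).
Proof.
rewrite -{1}[p]hsubmxK mul_row_block row_mxEl mulmx0 add0r mulmxN mulmx1.
by rewrite !mxE.
Qed.

Lemma mulJ_rshift p i : (p *m J) 0 (rshift m i) = p 0 (lshift m i).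
Proof.
by rewrite -{1}[p]hsubmxK mul_row_block row_mxEr mulmx0 addr0 mulmx1 mxE.
Qed.

Lemma mulJJ p : p *m J *m J = - p.
Proof.
apply/rowP => a; rewrite [RHS]mxE; case: (split_ordP a) => i ->.
  by rewrite mulJ_lshift mulJ_rshift.
by rewrite mulJ_rshift mulJ_lshift.
Qed.

Lemma dotJl u v : dot (u *m J) v = - dot u (v *m J).
Proof.
rewrite !dot_sum !big_split_ord /= opprD addrC -!sumrN.
congr (_ + _); apply: eq_bigr => i _;
  by rewrite !(mulJ_lshift, mulJ_rshift); ring.
Qed.

Lemma dotJ0 u : dot u (u *m J) = 0.
Proof. by have := dotJl u u; rewrite dotC; lra. Qed.

Lemma dotJJ u v : dot (u *m J) (v *m J) = dot u v.
Proof. by rewrite dotJl mulJJ innerNr opprK. Qed.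

(** The [f_SS] part of the Hermitian form is the product of [sum u_i conj(z_i)] with the conjugate
    of [sum v_j conj(z_j)]. The real and imaginary parts of the first factor are [u.p] and [u.Jp],
    whence the two outer products. *)
Lemma kaehler_metricE f p : kaehler_metric f p =
  (derive1n 1 f (normsq p))%:M
  + derive1n 2 f (normsq p) *: (p^T *m p + (p *m J)^T *m (p *m J)).
Proof.
have outer (u : 'rV[R]_(m + m)) a b : (u^T *m u) a b = u 0 a * u 0 b.
  by rewrite mxE big_ord1 mxE.
have zl (i j : 'I_m) :
    zcoord (delta_mx 0 (lshift m i) : 'rV[R]_(m + m)) j =
    ((1 : R) +i* (0 : R))%C * (j == i)%:R.
  rewrite /zcoord !mxE eqxx /= (inj_eq (@lshift_inj _ _)) eq_rlshift.
  by case: (j == i); simpc.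
have zr (i j : 'I_m) :
    zcoord (delta_mx 0 (rshift m i) : 'rV[R]_(m + m)) j =
    ((0 : R) +i* (1 : R))%C * (j == i)%:R.
  rewrite /zcoord !mxE eqxx /= (inj_eq (@rshift_inj _ _)) eq_lrshift.
  by case: (j == i); simpc.
(* A real coordinate vector has one nonzero complex coordinate, equal to 1 or [sqrt(-1)], so the
   double sum reduces to one entry of the Hermitian matrix. *)
have collapse (h : 'I_m -> 'I_m -> R[i]) (c d : R[i]) (i0 j0 : 'I_m) :
    \sum_i \sum_j h i j * (c * (i == i0)%:R * ((d * (j == j0)%:R)^*)%C) =
    h i0 j0 * (c * (d^*)%C).
  rewrite (bigD1 i0) //= [X in _ + X]big1 => [|i /negPf ->]; last first.
    by rewrite big1 // => j _; rewrite mulr0 mul0r mulr0.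
  rewrite (bigD1 j0) //= big1 => [|j /negPf ->]; last first.
    by rewrite [d * _]mulr0 conjc0 !mulr0.
  by rewrite !eqxx !mulr1 !addr0.
apply/matrixP => a b.
case: (split_ordP a) => i ->; case: (split_ordP b) => j ->;
  rewrite [LHS]mxE !(outer, mulJ_lshift, mulJ_rshift, mxE);
  rewrite ?(inj_eq (@lshift_inj _ _))
    ?(inj_eq (@rshift_inj _ _)) ?eq_lrshift ?eq_rlshift;
  (under eq_bigr => i' _ do under eq_bigr => j' _ do rewrite ?zl ?zr);
  rewrite collapse mxE /zcoord; case: (i == j); simpc; rewrite /=; ring.
Qed.


Lemma inner_kaehler f p u v : inner (kaehler_metric f p) u v =
  derive1n 1 f (normsq p) * dot u v
  + derive1n 2 f (normsq p) *
    (dot u p * dot v p + dot u (p *m J) * dot v (p *m J)).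
Proof.
have outer w : inner (w^T *m w) u v = dot u w * dot v w.
  by rewrite [dot v w]dotC !dotE /inner mulmxA -mulmxA mxE big_ord1 ord1.
by rewrite kaehler_metricE -[(derive1n 1 f _)%:M]scalemx1 innerDm !innerZm
  innerDm !outer.
Qed.

(** The metric acts on [p] and [Jp] by [f_S + S f_SS] and on their orthogonal complement by [f_S]. A
    kernel vector therefore loses its components along [p] and [Jp], and then its remaining part. *)
Lemma unitmx_kaehler f p : kaehler_profile f -> 0 < normsq p ->
  kaehler_metric f p \in unitmx.
Proof.
move=> fk p0; have [f1 f12] := fk _ p0.
rewrite -row_free_unit; apply: inj_row_free => u u0.
have gu w : inner (kaehler_metric f p) u w = 0.
  by rewrite /inner u0 mul0mx mxE.
have up : dot u p = 0.
  apply/eqP; rewrite -(mulIr_eq0 _ (mulIf (lt0r_neq0 f12))) -[0](gu p).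
  by rewrite inner_kaehler dotJ0 -normsq_dot; apply/eqP; ring.
have uJ : dot u (p *m J) = 0.
  apply/eqP; rewrite -(mulIr_eq0 _ (mulIf (lt0r_neq0 f12))) -[0](gu (p *m J)).
  rewrite inner_kaehler (dotC (p *m J) p) dotJ0 dotJJ -normsq_dot.
  by apply/eqP; ring.
have := gu u; rewrite inner_kaehler up uJ !mul0r addr0 mulr0 addr0 => /eqP.
by rewrite mulf_eq0 gt_eqF //= dot_eq0 => /eqP.
Qed.

(** * Derivatives of the metric and derivatives along the sphere *)

Lemma derive_normsq p u : 'D_u (@normsq R m) p = 2 * dot p u.
Proof.
rewrite derive_delta; last exact: differentiable_normsq.
rewrite dot_sum mulr_sumr; apply: eq_bigr => a _.
have h := is_derive_normsq p a.
by rewrite derive_val /GRing.scale /=; ring.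
Qed.

Lemma tangentE p v : tangent (@normsq R m) p v <-> dot p v = 0.
Proof.
rewrite /tangent derive_normsq; split=> [/eqP|->]; last by rewrite mulr0.
by rewrite mulf_eq0 pnatr_eq0 /= => /eqP.
Qed.

Lemma differentiable_normsq_comp (h : R -> R) p :
  derivable h (normsq p) 1 -> differentiable (fun q => h (normsq q)) p.
Proof.
move=> /derivable1_diffP dh; have dn := differentiable_normsq p.
exact: (@differentiable_comp _ _ _ _ (@normsq R m) h).
Qed.

Lemma is_derive_normsq_compv (h : R -> R) p u :
  derivable h (normsq p) 1 ->
  is_derive p u (fun q => h (normsq q)) (derive1 h (normsq p) * (2 * dot p u)).
Proof.
move=> dh; have dc := differentiable_normsq_comp dh.
apply: DeriveDef; first exact: diff_derivable.
rewrite derive_delta // dot_sum !mulr_sumr; apply: eq_bigr => a _.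
have h1 := is_derive_normsq_comp a dh.
by rewrite derive_val /GRing.scale /=; ring.
Qed.

Lemma is_derive_dotJ p u v :
  is_derive p u (fun q => dot v (q *m J)) (dot v (u *m J)).
Proof.
have e q : dot v (q *m J) = inner J^T v q.
  by rewrite /inner mulmx1 trmx_mul mulmxA.
rewrite e (_ : (fun q => _) = inner J^T v); last exact/funext.
exact: is_derive_innerr.
Qed.

Lemma inner_kaehler_fun f v w :
  (fun q => inner (kaehler_metric f q) v w) =
  dot v w \*: (fun q => derive1n 1 f (normsq q))
  + (fun q => derive1n 2 f (normsq q)) *
    (dot v * dot w + (fun q => dot v (q *m J)) * (fun q => dot w (q *m J))).
Proof. by apply/funext => q; rewrite inner_kaehler mulrC. Qed.

Lemma differentiable_kaehler f p b c : smooth_pos f -> 0 < normsq p ->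
  differentiable (fun q => kaehler_metric f q b c) p.
Proof.
move=> fs p0.
have -> : (fun q => kaehler_metric f q b c) =
    (fun q => inner (kaehler_metric f q) (delta_mx 0 b) (delta_mx 0 c)).
  by apply/funext => q; rewrite inner_delta.
have dJ w : differentiable (fun q => dot w (q *m J)) p.
  apply: (differentiable_comp (g := dot w)); first exact: differentiable_mulmxr.
  exact: differentiable_innerr.
rewrite inner_kaehler_fun; apply: differentiableD.
  exact/differentiableZ/differentiable_normsq_comp/(fs 1%N).
apply: differentiableM; first exact/differentiable_normsq_comp/(fs 2%N).
by apply: differentiableD; apply: differentiableM => //;
  apply: differentiable_innerr.
Qed.

(** The vectors [v] and [w] are held constant. The first line differentiates [f_S] and [f_SS], with
    [2 * dot p u] the derivative of the squared norm; the second differentiates the quadratic terms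
    in the base point. *)
Lemma derive_inner_kaehler f p u v w : smooth_pos f -> 0 < normsq p ->
  let f2 := derive1n 2 f (normsq p) in let f3 := derive1n 3 f (normsq p) in
  let y := p *m J in
  'D_u (fun q => inner (kaehler_metric f q) v w) p =
  2 * dot p u * (f2 * dot v w + f3 * (dot v p * dot w p + dot v y * dot w y))
  + f2 * (dot v u * dot w p + dot v p * dot w u
          + dot v (u *m J) * dot w y + dot v y * dot w (u *m J)).
Proof.
move=> fs p0 f2 f3 y.
rewrite inner_kaehler_fun.
have d1 : is_derive p u (fun q => derive1n 1 f (normsq q)) (f2 * (2 * dot p u)).
  exact: is_derive_normsq_compv (fs 1%N _ p0).
have d2 : is_derive p u (fun q => derive1n 2 f (normsq q)) (f3 * (2 * dot p u)).
  exact: is_derive_normsq_compv (fs 2%N _ p0).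
have dv := is_derive_innerr 1%:M p u v.
have dw := is_derive_innerr 1%:M p u w.
have dJv := is_derive_dotJ p u v.
have dJw := is_derive_dotJ p u w.
have [_ ->] := is_deriveD (is_deriveZ (dot v w) d1)
  (is_deriveM d2 (is_deriveD (is_deriveM dv dw) (is_deriveM dJv dJw))).
rewrite (_ : (dot v * dot w + _) p =
  dot v p * dot w p + dot v y * dot w y) // -/f2 -/y.
move: (dot p u) (dot v w) (dot v u) (dot v p) (dot w u) (dot w p)
  (dot v y) (dot w y) (dot v (u *m J)) (dot w (u *m J)) (f2) (f3).
by move=> *; rewrite /GRing.scale /=; ring.
Qed.

(* [t |-> (1 + k t^2)^-1 ((1 - k t^2) p + t v)], with [k = |v|^2 / (4 |p|^2)],
   is a curve in the sphere with velocity [v] at [p]. *)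
Lemma derive_sphere (h : 'rV[R]_(m + m) -> R) p v :
  0 < normsq p -> differentiable h p -> dot p v = 0 ->
  (forall q, normsq q = normsq p -> h q = 0) -> 'D_v h p = 0.
Proof.
move=> p0 dh pv h0.
pose k := dot v v / (4 * normsq p).
have k0 : 0 <= k.
  by rewrite divr_ge0 ?dot_ge0 // mulr_ge0 // ltW.
pose d (t : R) := 1 + k * t ^+ 2.
(* The denominator never vanishes, so the curve stays on the sphere for every [t] and [h \o gam] is
   identically zero. *)
have d_gt0 t : 0 < d t by rewrite ltr_wpDr // mulr_ge0 // sqr_ge0.
have dd : is_derive (0 : R) 1 d 0.
  have -> : d = cst 1 + k \*: (id ^+ 2) by [].
  apply: is_derive_eq; rewrite /GRing.scale /=; ring.
pose c t := (d t)^-1.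
have dc : is_derive (0 : R) 1 c 0.
  have dn0 : d 0 != 0 by rewrite gt_eqF.
  apply: DeriveDef; first exact: derivableV.
  by rewrite deriveV // derive_val scaler0.
(* This is [(1 - k t^2) / (1 + k t^2)], written so that only the derivative of [c] is needed. *)
pose a := cst (-1) + 2 \*: c.
pose b := id * c.
have da : is_derive (0 : R) 1 a 0.
  by apply: is_derive_eq; rewrite scaler0 addr0.
have c0 : c 0 = 1 by rewrite /c /d expr0n mulr0 addr0 invr1.
have db : is_derive (0 : R) 1 b 1.
  by apply: is_derive_eq; rewrite c0 /GRing.scale /= !(mulr0, mulr1) add0r.
pose gam t := a t *: p + b t *: v.
have gam0 : gam 0 = p.
  rewrite /gam /b /a /= (_ : (id * c) 0 = 0) ?mul0r //; last exact: mul0r.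
  rewrite (_ : (cst (-1) + 2 \*: c) 0 = -1 + 2 * c 0) // c0 scale0r addr0.
  by rewrite (_ : -1 + 2 * 1 = 1) ?scale1r //; ring.
have normg t : normsq (gam t) = normsq p.
  rewrite !normsq_dot /gam !(innerDl, innerDr, innerZl, innerZr).
  rewrite (dotC v p) pv -normsq_dot.
  have -> : dot v v = 4 * normsq p * k.
    by rewrite /k; field; rewrite gt_eqF.
  rewrite (_ : a t = -1 + 2 * (d t)^-1) // (_ : b t = t * (d t)^-1) //.
  rewrite /d; field; exact/lt0r_neq0/d_gt0.
have /derivable1_diffP daf : derivable a 0 1 by case: da.
have /derivable1_diffP dbf : derivable b 0 1 by case: db.
have dag : differentiable (fun t => a t *: p) 0 by exact: differentiableZl.
have dbg : differentiable (fun t => b t *: v) 0 by exact: differentiableZl.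
have dgam : differentiable gam 0 by exact: differentiableD.
have dgv : 'd gam 0 1 = v.
  have [_ dav] := da; have [_ dbv] := db.
  rewrite (diffD dag dbg) [LHS](congr2 +%R
    (congr1 (fun F => F 1) (diffZl p daf))
    (congr1 (fun F => F 1) (diffZl v dbf))).
  rewrite -(deriveE (1 : R) daf) -(deriveE (1 : R) dbf) dav dbv.
  by rewrite scale0r scale1r add0r.
have dhg : differentiable h (gam 0) by rewrite gam0.
have <- : 'd (h \o gam) (0 : R) (1 : R) = 'D_v h p.
  by rewrite (diff_comp dgam dhg) /= dgv -(deriveE _ dhg) gam0.
have -> : h \o gam = cst 0 by apply/funext => t; apply/h0.
by rewrite diff_cst.
Qed.

(** This is the product rule for [q.Y(q)]. That function vanishes only on the sphere, not near [p],
    so [derive_sphere] is what makes its derivative along the tangent vector [v] zero. *)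
Lemma dot_derive_tangent (Y : 'rV[R]_(m + m) -> 'rV[R]_(m + m)) p v :
  0 < normsq p -> differentiable Y p -> dot p v = 0 ->
  (forall q, normsq q = normsq p -> dot q (Y q) = 0) ->
  dot ('D_v Y p) p = - dot v (Y p).
Proof.
move=> p0 dY pv tY.
have dYa a : differentiable (fun q => Y q 0 a) p.
  exact: (differentiable_comp dY (differentiable_coord _ _ _)).
have dpa a : differentiable (fun q : 'rV[R]_(m + m) => q 0 a) p.
  exact: differentiable_coord.
have E : (fun q => dot q (Y q)) =
    \sum_a ((fun q : 'rV[R]_(m + m) => q 0 a) * (fun q => Y q 0 a)).
  by apply/funext => q; rewrite dot_sum fct_sumE.
have := @derive_sphere (fun q => dot q (Y q)) p v p0 _ pv tY.
have dE a := differentiableM (dpa a) (dYa a).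
rewrite E => /(_ (differentiable_sum dE)).
rewrite derive_sum => [|a]; last by apply: derivableM; apply: diff_derivable.
have dY' : derivable Y p v by exact: diff_derivable.
move=> h; apply/eqP; rewrite -addr_eq0 -h !dot_sum -big_split /=.
apply/eqP/eq_bigr => a _.
rewrite deriveM; [|exact: diff_derivable..].
rewrite (derive_mx dY') mxE.
have [_ ->] := is_derive_coord p v a.
by rewrite /GRing.scale /=; ring.
Qed.

(** * The outward unit normal *)

(** Testing the normal against the tangent vector [Jp], then against its own component orthogonal to
    [p], leaves a multiple of [p]. Unit length fixes the square of the factor, and the outward
    condition its sign. *)
Lemma outward_unit_normal_kaehler f p nu :
  kaehler_profile f -> 0 < normsq p ->
  outward_unit_normal (kaehler_metric f) (@normsq R m) p nu ->
  let D := derive1n 1 f (normsq p) + normsq p * derive1n 2 f (normsq p) in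
  nu = (Num.sqrt (normsq p) * Num.sqrt D)^-1 *: p.
Proof.
move=> fk p0 [ort unit out] D; have [f1 D0] := fk _ p0.
have nuJ : dot nu (p *m J) = 0.
  have /ort : tangent (@normsq R m) p (p *m J) by apply/tangentE/dotJ0.
  rewrite inner_kaehler (dotC (p *m J) p) dotJ0 dotJJ -normsq_dot => h.
  apply/eqP; rewrite -(mulIr_eq0 _ (mulIf (lt0r_neq0 D0))) -[0]h.
  by rewrite (dotC nu); apply/eqP; ring.
pose al := dot nu p / normsq p.
have nuE : nu = al *: p.
  (* Here [t] is tangent, and normality gives [f_S t.nu = 0]; since [t.p = 0] as well, [t.t = 0]. *)
  apply/eqP; rewrite -subr_eq0 -dot_eq0; set t := nu - _.
  have tp : dot t p = 0.
    rewrite /t innerDl -scaleNr innerZl -normsq_dot /al.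
    by field; rewrite gt_eqF.
  have /ort : tangent (@normsq R m) p t by apply/tangentE; rewrite dotC.
  rewrite inner_kaehler nuJ tp mul0r mulr0 add0r mulr0 addr0 => /eqP.
  rewrite mulf_eq0 gt_eqF //= => /eqP tnu.
  by rewrite {2}/t innerDr tnu innerNr innerZr tp mulr0 oppr0 addr0.
have al0 : 0 < al.
  by move: out; rewrite derive_normsq dotC => out; rewrite divr_gt0 //; lra.
have al2 : al ^+ 2 = (normsq p * D)^-1.
  have := unit.
  rewrite nuE innerZl innerZr inner_kaehler dotJ0 -normsq_dot => h.
  have pD0 : normsq p * D != 0 by rewrite mulf_neq0 // gt_eqF.
  by apply: (mulIf pD0); rewrite mulVf // -[RHS]h /D; ring.
rewrite {1}nuE; congr (_ *: _).
rewrite -sqrtrM ?ltW // -[LHS]ger0_norm ?ltW // -sqrtr_sqr al2 sqrtrV //.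
by rewrite mulr_ge0 ?ltW.
Qed.

(** * The second fundamental form *)

(** Pairing with [p] instead of the unit normal keeps square roots out of the computation; the
    factor is restored in [second_fundamental_form_kaehler]. *)
Lemma inner_nabla_kaehler f p (X Y : 'rV[R]_(m + m) -> 'rV[R]_(m + m)) :
  smooth_pos f -> kaehler_profile f -> 0 < normsq p ->
  tangent_field (~` [set 0]) (@normsq R m) (normsq p) X ->
  tangent_field (~` [set 0]) (@normsq R m) (normsq p) Y ->
  let f1 := derive1n 1 f (normsq p) in
  let f2 := derive1n 2 f (normsq p) in
  let f3 := derive1n 3 f (normsq p) in
  inner (kaehler_metric f p) (nabla (kaehler_metric f) X Y p) p =
  - ((f1 + normsq p * f2) * dot (X p) (Y p)
     + (2 * f2 + normsq p * f3) * dot (X p) (p *m J) * dot (Y p) (p *m J)).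
Proof.
move=> fs fk p0 [sX tX] [sY tY] f1 f2 f3.
(* A sphere of positive radius misses the origin, so it lies in the open set on which the fields are
   given. *)
have nz q : normsq q = normsq p -> (~` [set 0]) q.
  by move=> qp /= q0; move: p0; rewrite -qp q0 normsq_dot dotE mul0mx mxE ltxx.
have pX : dot p (X p) = 0 by apply/tangentE/tX => //; apply: nz.
have pY : dot p (Y p) = 0 by apply/tangentE/tY => //; apply: nz.
have dY : differentiable Y p by have [/(_ p) + _] := sY 1%N; apply; apply: nz.
have DY : dot ('D_(X p) Y p) p = - dot (X p) (Y p).
  by apply: dot_derive_tangent => // q qp; apply/tangentE/tY => //; apply: nz.
rewrite /nabla innerDl inner_christoffel.
(* In the Koszul term the contributions [S f_SS X.Y] cancel, leaving only the product of the
   components along [Jp]. *)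
- rewrite inner_kaehler DY dotJ0 -normsq_dot !derive_inner_kaehler //.
  rewrite -/f1 -/f2 -/f3 !dotJ0 -!normsq_dot pX pY.
  rewrite [dot (X p) p]dotC [dot (Y p) p]dotC pX pY [dot (Y p) (X p)]dotC.
  have pJ v : dot p (v *m J) = - dot v (p *m J) by rewrite -dotJl dotC.
  rewrite !pJ; move: (dot (X p) (Y p)) (dot (X p) (p *m J)).
  move: (dot (Y p) (p *m J)) (dot (X p) _) (dot (Y p) _).
  move: (normsq p) (f1) (f2) (f3) => *.
  by field.
- by move=> q; apply: kaehler_metric_sym.
- exact: unitmx_kaehler.
- by move=> b c; apply: differentiable_kaehler.
Qed.

(** A skew-symmetric matrix defines a linear field tangent to every sphere about the origin. The
    matrix [A] generates a rotation in the plane of [p] and [v], scaled to send [p] to [v]. *)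
Lemma tangent_extension p v : 0 < normsq p -> dot p v = 0 ->
  exists2 X, tangent_field (~` [set 0]) (@normsq R m) (normsq p) X & X p = v.
Proof.
move=> p0 pv.
pose A := (normsq p)^-1 *: (p^T *m v - v^T *m p).
have AE q : q *m A = (normsq p)^-1 *: (dot q p *: v - dot q v *: p).
  rewrite -scalemxAr mulmxBr !mulmxA !dotE.
  by rewrite [q *m p^T]mx11_scalar [q *m v^T]mx11_scalar !mul_scalar_mx !mxE.
exists (fun q => q *m A); last first.
  rewrite AE pv scale0r subr0 -normsq_dot scalerA mulVf ?scale1r //.
  by rewrite gt_eqF.
split; first exact: smooth_mulmxr.
move=> q _ _; apply/tangentE.
by rewrite AE innerZr innerDr innerNr !innerZr; ring.
Qed.

(** Extensions exist by [tangent_extension], and the value of [inner_nabla_kaehler] involves the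
    fields only through their values at [p], hence is independent of the extensions. *)
Lemma second_fundamental_form_kaehler f p nu v w :
  smooth_pos f -> kaehler_profile f -> 0 < normsq p ->
  outward_unit_normal (kaehler_metric f) (@normsq R m) p nu ->
  dot p v = 0 -> dot p w = 0 ->
  let f1 := derive1n 1 f (normsq p) in
  let f2 := derive1n 2 f (normsq p) in
  let f3 := derive1n 3 f (normsq p) in
  second_fundamental_form (~` [set 0]) (kaehler_metric f) (@normsq R m)
    (normsq p) p nu v w
    (- (((f1 + normsq p * f2) * dot v w
         + (2 * f2 + normsq p * f3) * dot v (p *m J) * dot w (p *m J))
        / (Num.sqrt (normsq p) * Num.sqrt (f1 + normsq p * f2)))).
Proof.
move=> fs fk p0 /(outward_unit_normal_kaehler fk p0) nuE pv pw f1 f2 f3.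
split=> [|X Y tX tY Xp Yp].
  have [X tX Xp] := tangent_extension p0 pv.
  have [Y tY Yp] := tangent_extension p0 pw.
  by exists X, Y.
rewrite nuE innerZr inner_nabla_kaehler // Xp Yp.
by rewrite mulrC mulNr.
Qed.

(** * Diagonalization and principal curvatures *)

(** The definition asks for a matrix with exactly [size l] rows; this form accepts a row count that
    is only provably equal to it, such as that of a [col_mx]. *)
Lemma principal_curvaturesI n (U : set 'rV[R]_n) (g : 'rV[R]_n -> 'M[R]_n)
    (rho : 'rV[R]_n -> R) (c : R) (x nu : 'rV[R]_n) (l : seq R) k
    (E : 'M[R]_(k, n)) :
  size l = k -> row_free E ->
  (forall v : 'rV[R]_n, (v <= E)%MS <-> tangent rho x v) ->
  (forall (i : 'I_k) (w : 'rV[R]_n), tangent rho x w ->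
     second_fundamental_form U g rho c x nu (row i E) w
       (l`_i * inner (g x) (row i E) w)) ->
  principal_curvatures U g rho c x nu l.
Proof. by move=> e; case: k / e E => E *; exists E. Qed.

Lemma mulmx_tr_eq0 u v : (u *m v^T == 0) = (dot u v == 0).
Proof.
rewrite dotE; apply/eqP/eqP => [->|h]; first by rewrite mxE.
by apply/rowP => i; rewrite !ord1 h mxE.
Qed.

(** The rows of [B] span the orthogonal complement of [p] and [Jp], obtained as a kernel. Adjoining
    [Jp] recovers the complement of [p] alone. *)
Lemma tangent_basis p : 0 < normsq p ->
  exists2 B : 'M[R]_(2 * m - 2, m + m),
    forall i, dot p (row i B) = 0 /\ dot (row i B) (p *m J) = 0 &
    row_free (col_mx B (p *m J)) /\
    (forall v, (v <= col_mx B (p *m J))%MS <-> dot p v = 0).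
Proof.
move=> p0; pose y := p *m J; pose K := kermx (col_mx p y)^T.
have yy : dot y y = normsq p by rewrite dotJJ normsq_dot.
have subK v : (v <= K)%MS = (dot v p == 0) && (dot v y == 0).
  by rewrite sub_kermx tr_col_mx mul_mx_row row_mx_eq0 !mulmx_tr_eq0.
have rK : \rank K = (2 * m - 2)%N.
  have rf : row_free (col_mx p y).
    (* [p] and [Jp] are orthogonal of equal length, so their Gram matrix is [normsq p] times the
       identity. *)
    apply/row_freeP; exists ((normsq p)^-1 *: (col_mx p y)^T).
    rewrite -scalemxAr tr_col_mx mul_col_row.
    rewrite [p *m p^T]mx11_scalar [p *m y^T]mx11_scalar [y *m p^T]mx11_scalar.
    rewrite [y *m y^T]mx11_scalar -!dotE dotJ0 (dotC y p) dotJ0 yy -normsq_dot.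
    rewrite raddf0 -scalar_mx_block scale_scalar_mx mulVf //.
    by rewrite gt_eqF.
  by rewrite mxrank_ker mxrank_tr (eqP rf); lia.
have [B [Bf BK]] : exists B : 'M[R]_(2 * m - 2, m + m),
    row_free B /\ (B :=: K)%MS.
  by rewrite -rK; exists (row_base K); split;
    [apply: row_base_free | apply: eq_row_base].
have rB i : dot p (row i B) = 0 /\ dot (row i B) y = 0.
  have : (row i B <= K)%MS by rewrite -BK row_sub.
  by rewrite subK dotC => /andP[/eqP-> /eqP->].
have By : B *m y^T = 0.
  by apply/row_matrixP => i; rewrite row_mul row0; apply/eqP;
    rewrite mulmx_tr_eq0 (rB i).2.
exists B => //; split=> [|v].
  apply: inj_row_free => u; rewrite -[u]hsubmxK mul_row_col => h.
  (* Multiplying the relation by [y^T] kills the rows of [B] and isolates the coefficient of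
     [Jp]. *)
  have u2 : rsubmx u = 0.
    have := congr1 (fun A => (A *m y^T) 0 0) h.
    rewrite mul0mx mulmxDl -mulmxA By mulmx0 add0r [rsubmx u]mx11_scalar.
    rewrite mul_scalar_mx -scalemxAl [LHS]mxE -dotE yy [RHS]mxE => /eqP.
    rewrite mulf_eq0 [normsq p == 0]gt_eqF // orbF => /eqP ->.
    exact: raddf0.
  move: h; rewrite u2 mul0mx addr0 => /eqP.
  rewrite mulmx_free_eq0 // => /eqP ->.
  exact: row_mx0.
split=> [|pv].
  have : (col_mx B y <= kermx p^T)%MS.
    rewrite col_mx_sub !sub_kermx [y *m _ == 0]mulmx_tr_eq0 dotC dotJ0 eqxx.
    rewrite andbT.
    apply/eqP/row_matrixP => i; rewrite row_mul row0; apply/eqP.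
    by rewrite mulmx_tr_eq0 dotC (rB i).1.
  move=> BP /submx_trans /(_ BP); rewrite sub_kermx mulmx_tr_eq0 dotC.
  by move/eqP.
(* The coefficient of the orthogonal projection of [v] onto [Jp]; the remainder is orthogonal to
   both [p] and [Jp]. *)
pose c := dot v y / normsq p.
rewrite -[v](subrK (c *: y)) -addsmxE addmx_sub_adds ?scalemx_sub //.
rewrite BK subK dotC innerDr innerNr innerZr pv dotJ0 mulr0 subr0 eqxx /=.
rewrite innerDl -scaleNr innerZl yy /c; apply/eqP; field.
by rewrite gt_eqF.
Qed.

(** The case of a basis vector [e] orthogonal to [p] and [Jp]: the zeros stand for [e.p] and [e.Jp],
    and [x], [y], [z] for [e.w], [w.Jp], [w.p]. The two sides agree because [f_S + S f_SS] is the
    square of its root. *)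
Lemma horizontal_curvature (S a b c x y z : R) :
  0 < S -> 0 < a -> 0 < a + S * b ->
  - (((a + S * b) * x + (2 * b + S * c) * 0 * y)
     / (Num.sqrt S * Num.sqrt (a + S * b))) =
  - (Num.sqrt (a + S * b) / (a * Num.sqrt S)) * (a * x + b * (0 * z + 0 * y)).
Proof.
move=> S0 a0 D0.
have : 0 < Num.sqrt S by rewrite sqrtr_gt0.
have : 0 < Num.sqrt (a + S * b) by rewrite sqrtr_gt0.
have := sqr_sqrtr (ltW D0).
move: (Num.sqrt _) (Num.sqrt S) => d s e d0 s0.
by rewrite -{1}e; field; rewrite !gt_eqF.
Qed.

(** The case of [Jp], with [x] for [Jp.w]. The numerator comes from [(a + S b) + S (2 b + S c) = a +
    3 S b + S^2 c], and [g(Jp, w) = (a + S b) x] accounts for the extra power in the denominator. *)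
Lemma vertical_curvature (S a b c x z : R) :
  0 < S -> 0 < a + S * b ->
  - (((a + S * b) * x + (2 * b + S * c) * S * x)
     / (Num.sqrt S * Num.sqrt (a + S * b))) =
  - ((a + 3 * S * b + S ^+ 2 * c) / ((a + S * b) `^ (3 / 2) * Num.sqrt S)) *
  (a * x + b * (0 * z + S * x)).
Proof.
move=> S0 D0.
have s0 : Num.sqrt S != 0 by rewrite gt_eqF // sqrtr_gt0.
have d0 : Num.sqrt (a + S * b) != 0 by rewrite gt_eqF // sqrtr_gt0.
have -> : (a + S * b) `^ (3 / 2) = (a + S * b) * Num.sqrt (a + S * b).
  rewrite (_ : 3 / 2 = 1 + 2^-1); last by field.
  by rewrite powRD ?powRr1 ?powR12_sqrt ?ltW // gt_eqF ?implybT.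
by field; rewrite s0 d0 gt_eqF.
Qed.

End Sphere.

Theorem theorem4p4 (R : realType) (m : nat) (hm : (2 <= m)%N) (f : R -> R)
    (f_smooth : smooth_pos f) (f_kaehler : kaehler_profile f)
    (S : R) (hS : 0 < S) (p : 'rV[R]_(m + m)) (hp : normsq p = S)
    (nu : 'rV[R]_(m + m))
    (hnu : outward_unit_normal (kaehler_metric f) (@normsq R m) p nu) :
  let f1 := derive1n 1 f S in
  let f2 := derive1n 2 f S in
  let f3 := derive1n 3 f S in
  principal_curvatures (~` [set 0]) (kaehler_metric f) (@normsq R m) S p nu
    (rcons
       (nseq (2 * m - 2)
          (- (Num.sqrt (f1 + S * f2) / (f1 * Num.sqrt S))))
       (- ((f1 + 3 * S * f2 + S ^+ 2 * f3)
           / ((f1 + S * f2) `^ (3 / 2) * Num.sqrt S)))).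
Proof.
move=> f1 f2 f3.
have [f1_gt0 D_gt0] : 0 < f1 /\ 0 < f1 + S * f2 := f_kaehler S hS.
have S0 : 0 < normsq p by rewrite hp.
have [B rB [Ef Espan]] := tangent_basis S0.
apply: (@principal_curvaturesI _ _ _ _ _ _ _ _ _ _ (col_mx B (p *m J))) => //.
- by rewrite size_rcons size_nseq addn1.
- by move=> v; rewrite Espan -tangentE.
(* The rows of [B] match the repeated entries of the list, and the last row [Jp] matches the entry
   appended by [rcons]. *)
move=> i w /tangentE pw; case: (split_ordP i) => j ->.
  have [pe ey] := rB j; rewrite rowKu /= nth_rcons.
  rewrite size_nseq ltn_ord nth_nseq ltn_ord.
  have := second_fundamental_form_kaehler f_smooth f_kaehler S0 hnu pe pw.
  rewrite hp -/f1 -/f2 -/f3 ey; congr second_fundamental_form.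
  rewrite inner_kaehler hp ey (dotC _ p) pe -/f1 -/f2.
  exact: horizontal_curvature.
have py := dotJ0 p.
(* The index is now exactly the length of the [nseq] block, so [nth] selects the appended entry and
   not the default. *)
rewrite [j]ord1 rowKd row_id nth_rcons size_nseq /= addn0 ltnn eqxx.
have := second_fundamental_form_kaehler f_smooth f_kaehler S0 hnu py pw.
rewrite hp -/f1 -/f2 -/f3 dotJJ -normsq_dot hp; congr second_fundamental_form.
rewrite inner_kaehler hp (dotC _ p) py dotJJ -normsq_dot hp -/f1 -/f2.
rewrite (dotC w); exact: vertical_curvature.
Qed.
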